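(* For every integer $n\geq 6$, $$f(n,3,2)=|\mathcal{L}(n,3,2)|,$$ where $f(n,3,2)$ is the maximum size of an intersecting family $\mathcal{F}\subset\binom{[n]}{3}$ with $\delta_{2}^+(\mathcal{F})\geq 2$, and $\mathcal{L}(n,3,2)=\left\{F\in\binom{[n]}{3}\colon |F\cap\{1,2,3\}|\geq 2\right\}$.
   Context: Here $[n]=\{1,2,\ldots,n\}$ and $\binom{[n]}{k}$ is the collection of all $k$-element subsets of $[n]$. A family $\mathcal{F}\subset\binom{[n]}{k}$ is intersecting if $F\cap F'\neq\emptyset$ for all $F,F'\in\mathcal{F}$. For $E\subset[n]$ let $\mathcal{F}(E)=\{F\setminus E\colon E\subset F\in\mathcal{F}\}$. The immediate shadow is $\partial\mathcal{F}=\left\{E\in\binom{[n]}{k-1}\colon E\subset F\text{ for some }F\in\mathcal{F}\right\}$. The shadow degree (minimum positive co-degree) is $\delta_{k-1}^+(\mathcal{F})=\min\{|\mathcal{F}(E)|\colon E\in\partial\mathcal{F}\}$; thus, for $k=3$, $\delta_{2}^+(\mathcal{F})\geq 2$ means that every $2$-element set $E\in\partial\mathcal{F}$ is contained in at least $2$ members of $\mathcal{F}$. *)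

(* Defs.v *)
From mathcomp Require Import all_boot.

Set Implicit Arguments.
Unset Strict Implicit.
Unset Printing Implicit Defensive.

(* The ground set [n] = {1, ..., n} is represented by 'I_n = {0, ..., n-1}:
   the ordinal i stands for the integer i + 1. *)

Definition ksubsets (n k : nat) : {set {set 'I_n}} :=
  [set A : {set 'I_n} | #|A| == k].

(* The two members are not required to be distinct. *)
Definition intersecting (n : nat) (F : {set {set 'I_n}}) : bool :=
  [forall A in F, forall B in F, A :&: B != set0].

Definition link (n : nat) (F : {set {set 'I_n}}) (E : {set 'I_n}) :
    {set {set 'I_n}} :=
  [set A :\: E | A in F & E \subset A].

Definition shadow (n k : nat) (F : {set {set 'I_n}}) : {set {set 'I_n}} :=
  [set E in ksubsets n k.-1 | [exists A in F, E \subset A]].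

(* Since #|link F E| <= #|F|, the default value #|F| does not affect the minimum
   when the shadow is nonempty; for F = set0 the value is 0. *)
Definition min_pos_codegree (n k : nat) (F : {set {set 'I_n}}) : nat :=
  \big[minn/#|F|]_(E in shadow k F) #|link F E|.

Definition admissible (n k s : nat) (F : {set {set 'I_n}}) : bool :=
  [&& F \subset ksubsets n k, intersecting F & s <= min_pos_codegree k F].

(* The maximum ranges over a finite set of families; it is 0 if no family is
   admissible. *)
Definition f (n k s : nat) : nat :=
  \max_(F : {set {set 'I_n}} | admissible k s F) #|F|.

(* The set [set i | i < 3] of ordinals encodes {1, 2, 3}. *)
Definition L32 (n : nat) : {set {set 'I_n}} :=
  [set A in ksubsets n 3 | 2 <= #|A :&: [set i : 'I_n | i < 3]|].

(* Main.v *)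
Require Import Defs.
From mathcomp Require Import all_boot zify.

Set Implicit Arguments.
Unset Strict Implicit.
Unset Printing Implicit Defensive.

(** Call a 3-set heavy for a 3-set C when it has at least two points in C.  The
    heavy sets of any C form an admissible family of size 3(n-3)+1
    ([card_heavy], [L32_admissible]), so it remains to bound an arbitrary
    admissible family F.

    Suppose first that two points a, b meet every member of F.  Outside {a, b},
    the graph of the pairs completing a to a member equals the one for b: if apq
    is a member, the pair pq lies in a second member, which has to be bpq.  As
    apq and brs must meet, this common graph is intersecting, hence a star or a
    triangle.  A star with centre c makes every member heavy for {a, b, c}; a
    triangle confines F to five points ([two_point_cover]).

    Suppose next that no two points meet every member, and that some pair ab is
    completed by three points x, y, z.  A member avoiding a and b must contain
    x, y and z, so it is xyz.  A point w outside {a, b, x, y, z} then forms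
    members with a and with b, over the same at least two points of {x, y, z};
    for two such points w, w' some of these members would be disjoint.  So F
    lives on at most six points ([codegree_three_support]).

    In the last case every pair inside a member lies in exactly two members.
    A member missing a point shows that the point has degree at most 3 * 2, and
    inclusion-exclusion over the three points of a member gives
    #|F| <= 3 * 6 - 3 * 2 + 1 = 13 ([codegree_two_bound]).

    An intersecting family of 3-sets on at most six points has at most 10
    members, since it contains at most one of two complementary 3-sets
    ([intersecting_six_points]).  As 3(n-3)+1 is at least 10 for n >= 6 and at
    least 13 for n >= 7, all cases fit. *)

(** * Heavy sets and families on six points *)

Definition heavy (T : finType) (C : {set T}) : {set {set T}} :=
  [set A : {set T} | (#|A| == 3) && (2 <= #|A :&: C|)].

(** Besides C itself, a heavy set arises from C by exchanging one point t of C
    for one point v outside; the pair (t, v) can be recovered from the set. *)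
Lemma card_heavy (T : finType) (C : {set T}) :
  #|C| = 3 -> #|heavy C| = (3 * (#|T| - 3)).+1.
Proof.
move=> cardC.
pose swap (p : T * T) := p.2 |: (C :\ p.1).
have outside p : p \in setX C (~: C) -> swap p :\: C = [set p.2].
  case: p => t v /setXP[/= Ct]; rewrite inE => nCv; apply/setP=> x.
  rewrite !inE; case: (x =P v) => [->|_]; first by rewrite nCv.
  by case: (x \in C); rewrite ?andbF.
have missing p : p \in setX C (~: C) -> C :\: swap p = [set p.1].
  case: p => t v /setXP[/= Ct]; rewrite inE => nCv; apply/setP=> x.
  rewrite !inE negb_or negb_and negbK; case: (x =P t) => [->|_] /=.
    by rewrite Ct !andbT; apply: contraNneq nCv => <-.
  by case: (x \in C); rewrite ?andbF.
have swap_inj : {in setX C (~: C) &, injective swap}.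
  move=> p q Dp Dq eq_pq; rewrite [p]surjective_pairing [q]surjective_pairing.
  congr (_, _); apply: set1_inj.
    by rewrite -!missing // eq_pq.
  by rewrite -!outside // eq_pq.
have -> : heavy C = C |: (swap @: setX C (~: C)).
  apply/setP=> A; rewrite !inE; apply/andP/idP.
    case=> /eqP cardA heavyA.
    have /= := cardsID C A; have := cardsID A C; rewrite (setIC C) cardA cardC.
    move=> sizeCA sizeAC.
    have : #|A :&: C| <= #|C| by apply/subset_leq_card/subsetIr.
    rewrite cardC leq_eqVlt => /orP[/eqP full|small].
      apply/orP; left; rewrite eqEcard cardA cardC leqnn andbT.
      have /eqP <- : A :&: C == A by rewrite eqEcard subsetIl full cardA.
      exact: subsetIr.
    have /cards1P[v defv] : #|A :\: C| == 1 by apply/eqP; lia.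
    have /cards1P[t deft] : #|C :\: A| == 1 by apply/eqP; lia.
    apply/orP; right; apply/imsetP; exists (t, v).
      have : v \in A :\: C by rewrite defv set11.
      have : t \in C :\: A by rewrite deft set11.
      by rewrite !inE => /andP[_ ->] /andP[].
    rewrite /swap /= -defv -deft; apply/setP=> x.
    by rewrite !inE; case: (x \in A); case: (x \in C).
  case/predU1P=> [->|/imsetP[[t v] /setXP[/= Ct]]].
    by rewrite setIid cardC.
  rewrite inE => nCv ->; rewrite /swap /=.
  have cardCt : #|C :\ t| = 2 by have := cardsD1 t C; rewrite Ct cardC; lia.
  split; first by rewrite cardsU1 cardCt !inE negb_and nCv orbT.
  rewrite -[X in X <= _]cardCt; apply/subset_leq_card/subsetP=> x.
  by rewrite !inE => /andP[-> ->]; rewrite orbT.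
rewrite cardsU1 (card_in_imset swap_inj) cardsX cardC.
have := cardsC C; rewrite cardC => <-.
suff -> : C \notin swap @: setX C (~: C) by lia.
apply/negP=> /imsetP[p Dp eqC]; have := outside p Dp.
by rewrite -eqC setDv => /setP/(_ p.2); rewrite !inE eqxx.
Qed.

(** On exactly six points, complementation in W maps F injectively to 3-sets
    outside F, so F has at most half of the 20 triples.  On five points there
    are only 10 triples in all. *)
Lemma intersecting_six_points (T : finType) (F : {set {set T}}) (W : {set T}) :
    {in F, forall A : {set T}, #|A| = 3} ->
    {in F &, forall A B : {set T}, A :&: B != set0} ->
    {in F, forall A : {set T}, A \subset W} ->
  #|W| <= 6 -> #|F| <= 10.
Proof.
move=> card3 meets subW; rewrite leq_eqVlt => /orP[/eqP card6|small].
  pose G := [set W :\: A | A in F].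
  have cardG : #|G| = #|F|.
    apply: card_in_imset => A B FA FB /(congr1 (fun X => W :\: X)).
    by rewrite !setDDr !setDv !set0U !(setIidPr _) ?subW.
  have disj : F :&: G = set0.
    apply/setP=> A; rewrite !inE; apply/negP=> /andP[FA /imsetP[B FB eqA]].
    have := meets _ _ FA FB; rewrite eqA => /set0Pn[x].
    by rewrite !inE; case: (x \in B); rewrite ?andbF.
  have sub : F :|: G \subset [set A : {set T} | A \subset W & #|A| == 3].
    apply/subsetP=> A; rewrite !inE => /orP[FA|/imsetP[B FB ->]].
      by rewrite subW //= card3.
    by rewrite subsetDl /= cardsDS ?subW // card6 card3.
  have := subset_leq_card sub.
  rewrite cards_draws card6 cardsU disj cards0 cardG.
  have -> : 'C(6, 3) = 20 by [].
  by lia.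
have sub : F \subset [set A : {set T} | A \subset W & #|A| == 3].
  by apply/subsetP=> A FA; rewrite inE subW //= card3.
apply: leq_trans (subset_leq_card sub) _; rewrite cards_draws.
by apply: (leq_trans (leq_bin2l 3 (small : #|W| <= 5))).
Qed.

(** * Intersecting triple systems without pairs of codegree one *)

Section TripleSystem.

Variables (T : finType) (F : {set {set T}}).
Hypothesis card3 : {in F, forall A : {set T}, #|A| = 3}.
Hypothesis meets : {in F &, forall A B : {set T}, A :&: B != set0}.
(* A codegree of at least two, said through members rather than links: every
   pair of points of a member lies in another member. *)
Hypothesis codeg2 : forall (A : {set T}) (a b : T),
  A \in F -> a \in A -> b \in A -> a != b ->
  exists2 B, B \in F & [/\ a \in B, b \in B & B != A].

Notation tri x y z := ([set x; y; z] \in F).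

Lemma third_point (A : {set T}) (a b : T) :
  A \in F -> a \in A -> b \in A -> a != b -> exists x, A = [set a; b; x].
Proof.
move=> FA Aa Ab ab; have := cardsD1 a A; have := cardsD1 b (A :\ a).
rewrite !inE eq_sym ab Aa Ab (card3 FA) => cardAab cardAa.
have /cards1P[x defx] : #|A :\ a :\ b| == 1 by apply/eqP; lia.
by exists x; rewrite -setUA -defx !setD1K // !inE eq_sym ab.
Qed.

Lemma other_points (A : {set T}) (a : T) :
  A \in F -> a \in A -> exists x y, A = [set a; x; y].
Proof.
move=> FA Aa; have := cardsD1 a A; rewrite Aa (card3 FA) => cardAa.
have /card_gt0P[x] : 0 < #|A :\ a| by lia.
rewrite !inE => /andP[xa Ax]; exists x.
by apply: third_point; rewrite // eq_sym.
Qed.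

Lemma tri_swap x y z : tri x y z -> tri y x z.
Proof. by rewrite (setUC [set x]). Qed.

Lemma tri_rot x y z : tri x y z -> tri y z x.
Proof. by rewrite -setUA setUC. Qed.

Lemma tri_neq x y z : tri x y z -> [/\ x <> y, y <> z & x <> z].
Proof.
move=> /card3; rewrite -setUA cardsU1 cards2 !inE => card_xyz.
by split; apply/eqP; move: card_xyz;
  case: (x =P y); case: (y =P z); case: (x =P z).
Qed.

Lemma tri_codeg x y z : tri x y z -> exists2 w, w <> z & tri x y w.
Proof.
move=> Fxyz; have [xy _ _] := tri_neq Fxyz.
have [||||B FB [Bx By neqB]] := @codeg2 [set x; y; z] x y;
  rewrite ?inE ?eqxx ?orbT //.
  exact/eqP.
have [w defB] := third_point FB Bx By (introN eqP xy).
by exists w; rewrite -?defB // => wz; move: neqB; rewrite defB wz eqxx.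
Qed.

Lemma tri_meet A x y z :
  A \in F -> tri x y z -> [\/ x \in A, y \in A | z \in A].
Proof.
move=> FA /(meets FA)/set0Pn[u]; rewrite !inE => /andP[Au].
by rewrite -orbA => /or3P[] /eqP <-; [apply: Or31 | apply: Or32 | apply: Or33].
Qed.

Lemma tri_meetE x y z u v w : tri x y z -> tri u v w ->
  [\/ [\/ u = x, u = y | u = z], [\/ v = x, v = y | v = z]
    | [\/ w = x, w = y | w = z]].
Proof.
move=> Fx Fu; have in3 t : t \in [set x; y; z] -> [\/ t = x, t = y | t = z].
  by rewrite !inE -orbA => /or3P[] /eqP ->;
    [apply: Or31 | apply: Or32 | apply: Or33].
by case: (tri_meet Fx Fu) => /in3; [apply: Or31 | apply: Or32 | apply: Or33].
Qed.

(** * Two points meeting every member *)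

Section TwoPointCover.

Variables a b : T.
Hypothesis ab : a != b.
Hypothesis cover_ab : {in F, forall A : {set T}, a \in A \/ b \in A}.

(* The definition names only the apex a; by [edge_apex] the graph of b is the
   same. *)
Let edge p q := [&& tri a p q, p != b & q != b].

Lemma edgeC p q : edge p q -> edge q p.
Proof. by case/and3P=> /tri_rot/tri_swap/tri_rot/tri_rot *; apply/and3P. Qed.

(** The second member through pq must contain a or b, and neither is p or q. *)
Lemma edge_both_apexes c p q : c = a \/ c = b -> tri c p q ->
  p <> a -> p <> b -> q <> a -> q <> b -> tri a p q /\ tri b p q.
Proof.
move=> c_ab Fcpq pa pb qa qb; have [w wc Fpqw] := tri_codeg (tri_rot Fcpq).
have : w = a \/ w = b.
  by case: (cover_ab Fpqw); rewrite !inE -orbA => /or3P[] /eqP;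
    intuition congruence.
move/tri_rot/tri_rot: Fpqw Fcpq => Fwpq Fcpq.
by case: c_ab => ?; case=> ?; subst.
Qed.

Lemma edge_apex p q : edge p q -> tri b p q.
Proof.
case/and3P=> Fapq /eqP pb /eqP qb; have [? ? ?] := tri_neq Fapq.
by have [] := edge_both_apexes (or_introl erefl) Fapq _ pb _ qb; auto.
Qed.

(** Since a and b are distinct and lie on no edge, apq and brs can only meet in
    the edges pq and rs. *)
Lemma edge_meet p q r s : edge p q -> edge r s ->
  [\/ r = p, r = q, s = p | s = q].
Proof.
move=> Epq Ers; have Fbrs := edge_apex Ers.
case/and3P: Epq Ers => Fapq /eqP pb /eqP qb /and3P[Fars /eqP rb /eqP sb].
have [? ? ?] := tri_neq Fapq; have [? ? ?] := tri_neq Fars; move/eqP: ab => nab.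
by case: (tri_meetE Fapq Fbrs) => [] [] ?; try congruence;
  [apply: Or41 | apply: Or42 | apply: Or43 | apply: Or44].
Qed.

(** In the only doubtful case the member is abx, and a second member through ax
    provides the edge. *)
Lemma edge_at A x : A \in F -> x \in A -> x <> a -> x <> b ->
  exists y, edge x y.
Proof.
move=> FA Ax xa xb.
have edge_c c : c = a \/ c = b -> c \in A -> exists y, edge x y.
  move=> c_ab Ac; have [|y defA] := third_point FA Ac Ax.
    by apply/eqP; case: c_ab; congruence.
  (* d is the other one of a and b, to be avoided as third point of c, x *)
  have [d [d_ab dc]] : exists d, (d = a \/ d = b) /\ d <> c.
    by move/eqP: ab; case: c_ab => ->; [exists b | exists a]; auto.
  have [w [wd Fcxw]] : exists w, w <> d /\ tri c x w.
    case: (y =P d) => [yd|]; last by exists y; rewrite -defA.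
    by have [|w] := @tri_codeg c x y; rewrite -?defA //; exists w; rewrite -?yd.
  have [? ? ?] := tri_neq Fcxw.
  have wa : w <> a by case: c_ab d_ab => ? []; congruence.
  have wb : w <> b by case: c_ab d_ab => ? []; congruence.
  have [Faxw _] := edge_both_apexes c_ab Fcxw xa xb wa wb.
  by exists w; apply/and3P; split=> //; apply/eqP.
by case: (cover_ab FA); apply: edge_c; auto.
Qed.

Lemma member_edge A : A \in F ->
  a \in A /\ b \in A \/
  (a \in A \/ b \in A) /\ exists p q, [/\ edge p q, p \in A & q \in A].
Proof.
move=> FA; have [Aa|nAa] := boolP (a \in A); have [Ab|nAb] := boolP (b \in A);
  first by left.
- right; split; first by left.
  have [p [q defA]] := other_points FA Aa; exists p, q.
  rewrite {1 2}defA !inE !eqxx !orbT; split=> //; apply/and3P.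
  by split; rewrite -?defA //; apply: contraNneq nAb => <-;
    rewrite defA !inE eqxx ?orbT.
- right; split; first by right.
  have [p [q defA]] := other_points FA Ab; exists p, q.
  have pa : p <> a by move=> pa; move: nAa; rewrite defA -pa !inE eqxx ?orbT.
  have qa : q <> a by move=> qa; move: nAa; rewrite defA -qa !inE eqxx ?orbT.
  rewrite defA in FA; have [bp pq bq] := tri_neq FA.
  have [Fapq _] :=
    edge_both_apexes (or_intror erefl) FA pa (nesym bp) qa (nesym bq).
  rewrite defA !inE !eqxx !orbT; split=> //; apply/and3P.
  by split; rewrite // eq_sym; apply/eqP.
- by case: (cover_ab FA) => Ax; rewrite Ax in nAa nAb.
Qed.

(** An intersecting graph is a star or a triangle.  A star centre extends ab to
    a 3-set for which all members are heavy.  Without a centre, an edge avoiding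
    p0 and an edge avoiding q0 complete p0 q0 to a triangle, which then contains
    every edge, hence by [edge_at] every point of a member other than a, b. *)
Lemma two_point_cover : F != set0 ->
  (exists2 C : {set T}, #|C| = 3 & F \subset heavy C) \/
  (exists2 W : {set T}, #|W| <= 6 & {in F, forall A : {set T}, A \subset W}).
Proof.
case/set0Pn=> A0 FA0; move/eqP: (ab) => nab.
have [p0 [q0 E0]] : exists p q, edge p q.
  case: (member_edge FA0) => [[A0a A0b]|[_ [p [q [? _ _]]]]];
    last by exists p, q.
  have [x defA0] := third_point FA0 A0a A0b ab.
  have [? ? ?] : [/\ a <> b, b <> x & a <> x] by apply: tri_neq; rewrite -defA0.
  have [|||y] := @edge_at A0 x FA0; last by exists x, y.
  - by rewrite defA0 !inE eqxx orbT.
  - by auto.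
  by auto.
have edge_ab p q : edge p q -> [/\ p <> a, p <> b, q <> a & q <> b].
  by case/and3P=> /tri_neq[? ? ?] /eqP pb /eqP qb; split; auto.
have [/existsP[c /forallP star]|no_star] :=
    boolP [exists c, [forall p, [forall q,
      edge p q ==> ((p == c) || (q == c))]]].
  have {}star p q : edge p q -> p = c \/ q = c.
    move=> Epq.
    by move/forallP/(_ q)/implyP/(_ Epq)/orP: (star p) => [] /eqP; auto.
  have [ca cb] : c <> a /\ c <> b.
    by have [? ? ? ?] := edge_ab _ _ E0; case: (star _ _ E0) => <-.
  left; exists [set a; b; c].
    rewrite -setUA cardsU1 cards2 !inE; move: ab.
    by do !case: eqP => //=; congruence.
  apply/subsetP=> A FA; rewrite inE card3 //=; apply/card_gt1P.
  case: (member_edge FA) => [[Aa Ab]|[Aab [p [q [Epq Ap Aq]]]]].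
    by exists a, b; rewrite !inE Aa Ab !eqxx !orbT.
  have Ac : c \in A by case: (star _ _ Epq) => <-.
  by case: Aab => Ax; [exists a, c | exists b, c];
    rewrite !inE Ax Ac !eqxx !orbT; split=> //; apply/eqP; auto.
have avoid c : exists p q, [/\ edge p q, p <> c & q <> c].
  move/existsPn/(_ c): no_star => /forallPn[p /forallPn[q]].
  by rewrite negb_imply negb_or => /and3P[Epq /eqP pc /eqP qc]; exists p, q.
have [r [Eqr rp]] : exists r, edge q0 r /\ r <> p0.
  have [r [s [Ers rp sp]]] := avoid p0.
  case: (edge_meet E0 Ers) => eq_q //; first by exists s; rewrite -eq_q.
  by exists r; rewrite -eq_q edgeC.
have [? ? ? ?] := edge_ab _ _ E0; have [_ _ ? ?] := edge_ab _ _ Eqr.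
have Epr : edge p0 r.
  have [s [t [Est sq tq]]] := avoid q0.
  (* st avoids q0, so it contains both p0 and r *)
  case: (edge_meet E0 Est) => eq_p; case: (edge_meet Eqr Est) => eq_q;
    try congruence; by rewrite -eq_p -eq_q edgeC.
have edge_sub s t : edge s t -> s \in [set a; b; p0; q0; r].
  move=> Est; have /and3P[/tri_neq[_ pq _] _ _] := E0.
  have /and3P[/tri_neq[_ qr _] _ _] := Eqr.
  rewrite !inE; do 5?case: eqP => //= ?; exfalso.
  by case: (edge_meet E0 Est) => ?; case: (edge_meet Eqr Est) => ?;
    case: (edge_meet Epr Est) => ?; congruence.
right; exists [set a; b; p0; q0; r].
  by rewrite -!setUA !cardsU1 cards1; do !case: (_ \notin _).
move=> A FA; apply/subsetP=> x Ax.
have [->|/eqP xa] := eqVneq x a; first by rewrite !inE eqxx.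
have [->|/eqP xb] := eqVneq x b; first by rewrite !inE eqxx orbT.
by have [y /edge_sub] := edge_at FA Ax xa xb.
Qed.

End TwoPointCover.

(** * A pair with three extensions *)

Section CodegreeThree.

Variables a b x y z : T.
Hypothesis xyz : [/\ x <> y, y <> z & x <> z].
Hypothesis extensions : [/\ tri a b x, tri a b y & tri a b z].
Variable D : {set T}.
Hypotheses (FD : D \in F) (nDa : a \notin D) (nDb : b \notin D).

Lemma tri_ext p : p \in [set x; y; z] -> tri a b p.
Proof. by case: extensions => ? ? ?; rewrite !inE -orbA => /or3P[] /eqP->. Qed.

(** Such an A meets abx, aby and abz, each time in the third point. *)
Lemma off_pair A : A \in F -> a \notin A -> b \notin A -> A = [set x; y; z].
Proof.
move=> FA nAa nAb; apply/esym/eqP; rewrite eqEcard card3 //.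
have -> : #|[set x; y; z]| = 3.
  case: xyz => ? ? ?; rewrite -setUA cardsU1 cards2 !inE.
  by do !case: eqP.
rewrite andbT; apply/subsetP=> p /tri_ext/(tri_meet FA).
by rewrite (negPf nAa) (negPf nAb) => -[].
Qed.

Lemma off_pair_member : tri x y z.
Proof. by rewrite -(off_pair FD nDa nDb). Qed.

(** The second member through wp contains w, so it is not xyz and has to contain
    a or b; as c is excluded, its third point is d. *)
Lemma far_swap c d w p : (c = a /\ d = b) \/ (c = b /\ d = a) ->
  w \notin [set a; b; x; y; z] -> p \in [set x; y; z] ->
  tri c w p -> tri d w p.
Proof.
move=> cd far p_in Fcwp; have [u uc Fwpu] := tri_codeg (tri_rot Fcwp).
have [? ? ?] := tri_neq (tri_ext p_in).
have [? ?] : w <> a /\ w <> b.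
  by split=> eq_w; move: far; rewrite eq_w !inE eqxx ?orbT.
have w_xyz : w \notin [set x; y; z].
  by apply: contra far; rewrite !inE -!orbA => /or3P[] ->; rewrite ?orbT.
suff ud : u = d by rewrite -ud; do 2!apply: tri_rot.
have [wp_a|nwp_a] := boolP (a \in [set w; p; u]).
  by move: wp_a; rewrite !inE -orbA => /or3P[] /eqP;
    case: cd => -[]; congruence.
have [wp_b|nwp_b] := boolP (b \in [set w; p; u]).
  by move: wp_b; rewrite !inE -orbA => /or3P[] /eqP;
    case: cd => -[]; congruence.
by move: w_xyz; rewrite -(off_pair Fwpu) // !inE eqxx.
Qed.

(** A member through w is not xyz, so it contains a or b; it meets xyz, so its
    third point is in {x, y, z}.  This gives p, and the second member through aw
    gives q; [far_swap] exchanges a and b. *)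
Lemma far_point w A : w \notin [set a; b; x; y; z] -> A \in F -> w \in A ->
  exists p q, [/\ p <> q, p \in [set x; y; z] /\ q \in [set x; y; z],
    tri a w p /\ tri a w q & tri b w p /\ tri b w q].
Proof.
move=> far FA Aw.
have ab : a <> b by case: extensions => /tri_neq[].
have w_xyz : w \notin [set x; y; z].
  by apply: contra far; rewrite !inE -!orbA => /or3P[] ->; rewrite ?orbT.
have [wa wb] : w <> a /\ w <> b.
  by split=> eq_w; move: far; rewrite eq_w !inE eqxx ?orbT.
have hits c u : c = a \/ c = b -> tri c w u -> u \in [set x; y; z].
  move=> c_ab Fcwu; have c_xyz : c \notin [set x; y; z].
    by apply/negP=> /tri_ext/tri_neq[? ? ?]; case: c_ab; congruence.
  have in_xyz v : v \in [set c; w; u] -> v \in [set x; y; z] ->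
      u \in [set x; y; z].
    case/setUP=> [/set2P[]|/set1P] -> //.
      by rewrite (negPf c_xyz).
    by rewrite (negPf w_xyz).
  by have /set0Pn[v /setIP[]] := meets Fcwu off_pair_member; apply: in_xyz.
have [p Fawp] : exists p, tri a w p.
  have start c : c = a \/ c = b -> c \in A -> exists p, tri a w p.
    move=> c_ab Ac; have [|p defA] := third_point FA Ac Aw.
      by apply/eqP; case: c_ab; congruence.
    exists p; rewrite defA in FA.
    case: (c_ab) => eq_c; rewrite eq_c in FA => //.
    by apply: (far_swap (or_intror (conj erefl erefl))) far (hits b p _ FA) FA;
      auto.
  have [Aa|nAa] := boolP (a \in A); first by apply: (start a); auto.
  have [Ab|nAb] := boolP (b \in A); first by apply: (start b); auto.
  by move: Aw; rewrite (off_pair FA) // (negPf w_xyz).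
have [q qp Fawq] := tri_codeg Fawp; exists p, q.
have both u : tri a w u -> tri b w u.
  move=> F1.
  by apply: far_swap (or_introl (conj erefl erefl)) far (hits a u _ F1) F1;
    auto.
by split; [exact: nesym | split; apply: (hits a); auto | | split; auto].
Qed.

(** Two distinct outer points w, w' are impossible: with p, q for w and p' for w'
    as in [far_point], awp and bw'p' meet only if p = p', and awq and bw'p' only
    if q = p', but p and q differ. *)
Lemma codegree_three_support :
  exists2 W : {set T}, #|W| <= 6 & {in F, forall A : {set T}, A \subset W}.
Proof.
have ab : a <> b by case: extensions => /tri_neq[].
have far_unique w w' A A' : w \notin [set a; b; x; y; z] ->
    w' \notin [set a; b; x; y; z] ->
    A \in F -> A' \in F -> w \in A -> w' \in A' -> w = w'.
  move=> far far' FA FA' Aw Aw'; apply/eqP; apply: contraT => /eqP ww'.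
  have [p [q [pq [in_p in_q] [Fawp Fawq] _]]] := far_point far FA Aw.
  have [p' [_ [_ [in_p' _] _ [Fbwp _]]]] := far_point far' FA' Aw'.
  have eq_far u u' : u \in [set x; y; z] -> u' \in [set x; y; z] ->
      tri a w u -> tri b w' u' -> u' = u.
    move=> in_u in_u' Fu Fu'; have := tri_meetE Fu Fu'.
    have [? ? ?] := tri_neq (tri_ext in_u).
    have [? ? ?] := tri_neq (tri_ext in_u').
    have avoids v t : t \notin [set a; b; x; y; z] -> v \in [set x; y; z] ->
        [/\ t <> a, t <> b & t <> v].
      move=> ft iv; split=> eq_t; move: ft; rewrite eq_t ?inE ?eqxx ?orbT //.
      by move: iv; rewrite !inE -!orbA => /or3P[] ->; rewrite ?orbT.
    have [? ? ?] := avoids _ _ far in_u'; have [? ? ?] := avoids _ _ far' in_u.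
    by case=> -[]; congruence.
  by case: pq; rewrite -(eq_far p p') // (eq_far q p').
have [/existsP[w /andP[far /existsP[A /andP[FA Aw]]]]|none] :=
    boolP [exists w, (w \notin [set a; b; x; y; z]) &&
                     [exists A : {set T}, (A \in F) && (w \in A)]].
  exists (w |: [set a; b; x; y; z]).
    by rewrite -!setUA !cardsU1 cards1; do !case: (_ \notin _).
  move=> B FB; apply/subsetP=> v Bv; rewrite in_setU1.
  have [|far'] := boolP (v \in _); first by rewrite orbT.
  by rewrite (far_unique v w B A) ?eqxx.
exists [set a; b; x; y; z].
  by rewrite -!setUA !cardsU1 cards1; do !case: (_ \notin _).
move=> B FB; apply/subsetP=> v Bv; apply: contraT => far.
move/existsPn/(_ v): none; rewrite far /= => /existsPn/(_ B).
by rewrite FB Bv.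
Qed.

End CodegreeThree.

(** * All codegrees equal to two *)

Section CodegreeTwo.

Let star p := [set A in F | p \in A].

Hypothesis no_cover : forall a b, a != b ->
  exists2 D, D \in F & (a \notin D) && (b \notin D).
Hypothesis codeg_le2 : forall a b, a != b -> #|star a :&: star b| <= 2.

(** Members through a meet a member missing a in one of its three points, and
    each of these three pairs has codegree at most two.  The point b only serves
    to obtain a member missing a. *)
Lemma degree_le6 a b : a != b -> #|star a| <= 6.
Proof.
case/no_cover=> D FD /andP[nDa _].
have [x0 Dx0] : exists x, x \in D by apply/card_gt0P; rewrite card3.
have [x [y defD]] := other_points FD Dx0.
have sub : star a \subset
    (star a :&: star x0) :|: (star a :&: star x) :|: (star a :&: star y).
  apply/subsetP=> A; rewrite !inE => /andP[FA ->]; rewrite FA /=.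
  by have := FD; rewrite {1}defD => /(tri_meet FA)[] ->; rewrite ?orbT.
have off v : v \in D -> a != v by apply: contraTneq => <-.
apply: leq_trans (subset_leq_card sub) _.
do 2!rewrite cardsU.
have := codeg_le2 (off x0 Dx0).
have := codeg_le2 (off x _).
have := codeg_le2 (off y _).
rewrite defD !inE !eqxx ?orbT => /(_ isT) ? /(_ isT) ? ?; lia.
Qed.

(** Every member meets a fixed member, so F is the union of three stars of size
    at most 6; they intersect pairwise in at least 2 members, and all three
    share only the fixed member: 18 - 6 + 1. *)
Lemma codegree_two_bound : F != set0 -> #|F| <= 13.
Proof.
case/set0Pn=> A FA.
have [x0 Ax0] : exists x, x \in A by apply/card_gt0P; rewrite card3.
have [y0 [z0 defA]] := other_points FA Ax0.
move: FA; rewrite defA => FA; have [/eqP xy /eqP yz /eqP xz] := tri_neq FA.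
have ge2 c d : c != d -> c \in A -> d \in A -> 2 <= #|star c :&: star d|.
  rewrite defA => cd Ac Ad; have [B FB [Bc Bd neqB]] := codeg2 FA Ac Ad cd.
  apply/card_gt1P; exists B, [set x0; y0; z0].
  by rewrite !inE FB FA Bc Bd neqB; move: Ac Ad; rewrite !inE => -> ->.
have le1 : #|star x0 :&: star y0 :&: star z0| <= 1.
  rewrite -(cards1 A); apply/subset_leq_card/subsetP=> B; rewrite !inE.
  case/andP=> /andP[/andP[FB Bx] /andP[_ By]] /andP[_ Bz].
  rewrite eq_sym eqEcard card3 // defA card3 // andbT.
  by apply/subsetP=> v; rewrite !inE -orbA => /or3P[] /eqP ->.
have defF : F = star x0 :|: star y0 :|: star z0.
  apply/setP=> B; rewrite !inE -!andb_orr; case FB: (B \in F) => //=.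
  by case: (tri_meet FB FA) => ->; rewrite ?orbT.
have := degree_le6 xy; have := degree_le6 yz.
have := @degree_le6 z0 y0; rewrite eq_sym yz => /(_ isT).
have := ge2 _ _ xy; have := ge2 _ _ yz; have := ge2 _ _ xz.
rewrite defA !inE !eqxx ?orbT => /(_ isT isT) ? /(_ isT isT) ? /(_ isT isT) ?.
move=> ? ? ?; rewrite defF !cardsU setIUl cardsU.
have -> : star x0 :&: star z0 :&: (star y0 :&: star z0) =
          star x0 :&: star y0 :&: star z0.
  by rewrite setIACA setIid.
by lia.
Qed.

End CodegreeTwo.
End TripleSystem.

(** * Admissible families *)

Lemma leq_bigminn (I : finType) (P : pred I) (G : I -> nat) (m s : nat) :
  (s <= \big[minn/m]_(i | P i) G i) = (s <= m) && [forall (i | P i), s <= G i].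
Proof.
apply/idP/andP=> [le_s|[le_m /forall_inP le_G]]; last first.
  by elim/big_ind: _ => // p q; rewrite leq_min => -> ->.
suff [le_m le_G] : s <= m /\ forall i, i \in index_enum I -> P i -> s <= G i.
  by split=> //; apply/forall_inP=> i Pi; apply: le_G; rewrite ?mem_index_enum.
elim: (index_enum I) le_s => [|j r IHr]; first by rewrite big_nil.
rewrite big_cons; case: ifP => [Pj|nPj].
  rewrite leq_min => /andP[le_j /IHr[le_m le_r]]; split=> // i.
  by rewrite inE => /predU1P[->|/le_r].
case/IHr=> le_m le_r; split=> // i.
by rewrite inE => /predU1P[->|/le_r]; rewrite ?nPj.
Qed.

Section Admissible.

Variables (n : nat) (F : {set {set 'I_n}}).

Lemma admissible_codegree : 2 <= min_pos_codegree 3 F ->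
  forall (A : {set 'I_n}) (a b : 'I_n),
    A \in F -> a \in A -> b \in A -> a != b ->
  exists2 B, B \in F & [/\ a \in B, b \in B & B != A].
Proof.
rewrite leq_bigminn => /andP[_ /forall_inP codeg] A a b FA Aa Ab ab.
have sub (X : {set 'I_n}) : ([set a; b] \subset X) = (a \in X) && (b \in X).
  by rewrite subUset !sub1set.
have /codeg/card_gt1P[X [Y [LX LY XY]]] : [set a; b] \in shadow 3 F.
  by rewrite !inE cards2 ab; apply/existsP; exists A; rewrite FA sub Aa Ab.
have [Z LZ ZA] : exists2 Z, Z \in link F [set a; b] & Z != A :\: [set a; b].
  by have [eqX|] := eqVneq X (A :\: [set a; b]);
    [exists Y; rewrite // -eqX eq_sym | exists X].
case/imsetP: LZ ZA => B; rewrite inE sub => /and3P[FB Ba Bb] -> neq.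
by exists B => //; split=> //; apply: contraNneq neq => ->.
Qed.

Lemma L32E : L32 n = heavy [set i : 'I_n | i < 3].
Proof. by apply/setP=> A; rewrite !inE. Qed.

Hypothesis hn : 6 <= n.

Lemma card_first3 : #|[set i : 'I_n | i < 3]| = 3.
Proof.
have -> : [set i : 'I_n | i < 3] =
    [set widen_ord (leq_trans (isT : 3 <= 6) hn) i | i : 'I_3].
  apply/setP=> i; rewrite inE; apply/idP/imsetP=> [lt_i|[j _ ->]];
    last exact: (ltn_ord j).
  by exists (Ordinal lt_i); last exact: val_inj.
by rewrite card_imset ?card_ord // => i j /(congr1 val) /= /val_inj.
Qed.

Lemma card_L32 : #|L32 n| = (3 * (n - 3)).+1.
Proof. by rewrite L32E card_heavy ?card_first3 // card_ord. Qed.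

(** Two subsets of C with two points each share a point, as C has only three. *)
Lemma heavy_intersecting (C : {set 'I_n}) : #|C| = 3 -> intersecting (heavy C).
Proof.
move=> cardC; apply/forall_inP=> A HA; apply/forall_inP=> B HB.
move: HA HB; rewrite !inE => /andP[_ hA] /andP[_ hB].
have : #|(A :&: C) :|: (B :&: C)| <= #|C|.
  by apply: subset_leq_card; rewrite subUset !subsetIr.
rewrite cardC cardsU => le3.
have /card_gt0P[x] : 0 < #|A :&: C :&: (B :&: C)| by lia.
rewrite !inE => /andP[/andP[Ax _] /andP[Bx _]].
by apply/set0Pn; exists x; rewrite inE Ax.
Qed.

(** A shadow pair E has a point in C.  If E has two, any third point completes
    it to a heavy set; if one, each of the two other points of C does. *)
Lemma heavy_codegree (C : {set 'I_n}) :
  #|C| = 3 -> 2 <= min_pos_codegree 3 (heavy C).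
Proof.
move=> cardC; rewrite leq_bigminn card_heavy // card_ord.
apply/andP; split; first by lia.
apply/forall_inP=> E; rewrite !inE.
case/andP=> /eqP/= cardE /existsP[A /andP[HA sEA]].
move: HA; rewrite inE => /andP[/eqP cardA hA].
have EC1 : 1 <= #|E :&: C|.
  have := cardsDS sEA; rewrite cardA cardE => cardAE.
  have sub : A :&: C \subset (E :&: C) :|: (A :\: E).
    by apply/subsetP=> x; rewrite !inE => /andP[-> ->]; case: (x \in E).
  have := subset_leq_card sub; rewrite cardsU; lia.
pose V := if E \subset C then ~: E else C :\: E.
have [v [w [Vv Vw vw]]] : exists v w, [/\ v \in V, w \in V & v != w].
  apply/card_gt1P; rewrite /V; case: ifP => [_|nEC].
    by have := cardsC E; rewrite cardE card_ord; lia.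
  have := cardsID E C; rewrite cardC setIC.
  suff : #|E :&: C| < #|E| by rewrite cardE; lia.
  apply: proper_card; rewrite properEneq subsetIl andbT.
  by apply: contraFneq nEC => <-; apply: subsetIr.
have in_link u : u \in V -> [set u] \in link (heavy C) E.
  move=> Vu; have nEu : u \notin E.
    by move: Vu; rewrite /V; case: ifP; rewrite !inE // => _ /andP[].
  apply/imsetP; exists (u |: E); last first.
    by apply/setP=> x; rewrite !inE; case: (x =P u) => [->|_];
      rewrite ?nEu // andNb.
  rewrite !inE cardsU1 nEu cardE subsetU1 andbT eqxx /=.
  move: Vu; rewrite /V; case: ifP => [sEC _|_].
    by rewrite -cardE; apply/subset_leq_card; rewrite subsetI sEC subsetU1.
  rewrite inE => /andP[_ Cu].
  have -> : (u |: E) :&: C = u |: (E :&: C).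
    by apply/setP=> x; rewrite !inE; case: eqP => // ->.
  by rewrite cardsU1 inE (negPf nEu).
apply/card_gt1P; exists [set v], [set w]; rewrite !in_link //; split=> //.
by apply: contraNneq vw => /set1_inj ->.
Qed.

Lemma L32_admissible : admissible 3 2 (L32 n).
Proof.
rewrite /admissible L32E heavy_intersecting ?heavy_codegree ?card_first3 //.
rewrite !andbT.
by apply/subsetP=> A; rewrite !inE => /andP[].
Qed.

Lemma admissible_bound : admissible 3 2 F -> #|F| <= #|L32 n|.
Proof.
case/and3P=> sub3 /forall_inP int codeg.
have card3 : {in F, forall A : {set 'I_n}, #|A| = 3}.
  by move=> A /(subsetP sub3); rewrite inE => /eqP.
have meets : {in F &, forall A B : {set 'I_n}, A :&: B != set0}.
  by move=> A B FA FB; move/forall_inP: (int A FA); apply.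
have codeg2 := admissible_codegree codeg.
rewrite card_L32; have [->|F0] := eqVneq F set0; first by rewrite cards0.
have six_points : (exists2 W : {set 'I_n}, #|W| <= 6 &
    {in F, forall A : {set 'I_n}, A \subset W}) -> #|F| <= (3 * (n - 3)).+1.
  case=> W cardW subW.
  have := intersecting_six_points card3 meets subW cardW; lia.
have [n6|n7] := leqP n 6.
  by apply: six_points; exists setT => [|A _];
    rewrite ?subsetT // cardsT card_ord.
pose cover a b := [forall A in F, (a \in A) || (b \in A)].
have [/existsP[a /existsP[b /andP[ab /forall_inP cov]]]|no_cov] :=
    boolP [exists a, exists b, (a != b) && cover a b].
  have {}cov : {in F, forall A : {set 'I_n}, a \in A \/ b \in A}.
    by move=> A /cov/orP.
  have [[C cardC sub]|] :=
    two_point_cover card3 meets codeg2 ab cov F0; last by [].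
  by apply: leq_trans (subset_leq_card sub) _; rewrite card_heavy // card_ord.
have no_cover a b : a != b ->
    exists2 D, D \in F & (a \notin D) && (b \notin D).
  move=> ab; move/existsPn/(_ a)/existsPn/(_ b): no_cov; rewrite ab /=.
  by case/forall_inPn=> D FD; rewrite negb_or; exists D.
pose star p := [set A in F | p \in A].
have [/existsP[a /existsP[b /andP[ab big]]]|small] :=
    boolP [exists a, exists b, (a != b) && (2 < #|star a :&: star b|)].
  have [D FD /andP[nDa nDb]] := no_cover a b ab.
  have third A : A \in star a :&: star b -> exists x, A = [set a; b; x].
    rewrite !inE => /andP[/andP[FA Aa] /andP[_ Ab]].
    by apply: third_point FA _ _ _.
  have /card_gt2P[X [Y [Z [[SX SY SZ] [XY YZ ZX]]]]] := big.
  have [x defX] := third _ SX; have [y defY] := third _ SY.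
  have [z defZ] := third _ SZ.
  apply: six_points.
  apply: (@codegree_three_support _ F _ _ _ a b x y z _ _ D) => //.
    split=> eq_xy; [case/eqP: XY | case/eqP: YZ | case/eqP: ZX];
      by rewrite ?defX ?defY ?defZ eq_xy.
  move: SX SY SZ; rewrite !inE -defX -defY -defZ => /andP[/andP[-> _] _].
  by move=> /andP[/andP[-> _] _] /andP[/andP[-> _] _].
have codeg_le2 a b : a != b -> #|star a :&: star b| <= 2.
  move=> ab; move/existsPn/(_ a)/existsPn/(_ b): small.
  by rewrite ab -leqNgt.
have := codegree_two_bound card3 meets codeg2 no_cover codeg_le2 F0; lia.
Qed.

End Admissible.

Theorem theorem1p8 (n : nat) (hn : 6 <= n) : f n 3 2 = #|L32 n|.
Proof.
apply/eqP; rewrite eqn_leq; apply/andP; split.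
  by apply/bigmax_leqP=> F; apply: admissible_bound.
exact: (bigmax_sup (L32 n) (L32_admissible hn)).
Qed.
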